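(* Let $\iota>1$, let $m<n$ and $s\in\{1,\dots,n\}$, and let $A\in\mathbb{R}^{m\times n}$ be a matrix with $\ell_2$-normalized columns whose coherence $\mu=\mu(A)$ satisfies $$\mu<\frac{\sqrt{\iota-1}}{\sqrt{\iota}\,(\iota s-1)}.$$ Then for all $x\in\mathbb{R}^n$, $$\|x_{\max(s)}\|_2\le\frac{(\iota s-1)\mu}{\sqrt{(\iota-1)\Big(1-\big((\iota s-1)\mu\big)^2\Big)}}\,\frac{\|x_{-\max(s)}\|_1}{\sqrt{s}}+\frac{2\sqrt{1+(\iota s-1)\mu}}{1-\big((\iota s-1)\mu\big)^2}\,\|Ax\|_2$$ and $$\|x_{\max(s)}\|_2\le\frac{(\iota s-1)\mu}{\sqrt{(\iota-1)\Big(1-\big((\iota s-1)\mu\big)^2\Big)}}\,\frac{\|x_{-\max(s)}\|_1}{\sqrt{s}}+\frac{2\sqrt{\iota s}}{1-\big((\iota s-1)\mu\big)^2}\,\|A^*Ax\|_\infty .$$ That is, with $$\rho=\frac{(\iota s-1)\mu}{\sqrt{(\iota-1)(1-((\iota s-1)\mu)^2)}},\quad \tau_1=\frac{2\sqrt{1+(\iota s-1)\mu}}{1-((\iota s-1)\mu)^2},\quad \tau_2=\frac{2\sqrt{\iota s}}{1-((\iota s-1)\mu)^2},$$ $A$ satisfies the $\ell_2$-robust null space property of order $s$ with $\ell_2$ bound with constant pair $(\rho,\tau_1)$, and the $\ell_2$-robust null space property of order $s$ with Dantzig selector bound with constant pair $(\rho,\tau_2)$.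
   Context: For a matrix $A\in\mathbb{R}^{m\times n}$ with columns $A_1,\dots,A_n$ satisfying $\|A_i\|_2=1$ for all $i$, the coherence is $\mu(A)=\max_{1\le i\ne j\le n}|\langle A_i,A_j\rangle|$. $A^*$ is the transpose of $A$. For $x\in\mathbb{R}^n$, $x_{\max(s)}$ is the vector $x$ with all but the largest $s$ entries in absolute value set to zero, and $x_{-\max(s)}=x-x_{\max(s)}$. For $q\ge1$, $A$ satisfies the $\ell_q$-robust null space property of order $s$ with $\ell_2$ bound with constant pair $(\rho,\tau)$ if $\|x_{\max(s)}\|_q\le\rho s^{1/q-1}\|x_{-\max(s)}\|_1+\tau\|Ax\|_2$ for all $x\in\mathbb{R}^n$; it satisfies the $\ell_q$-robust null space property of order $s$ with Dantzig selector bound with constant pair $(\rho,\tau)$ if $\|x_{\max(s)}\|_q\le\rho s^{1/q-1}\|x_{-\max(s)}\|_1+\tau\|A^*Ax\|_\infty$ for all $x\in\mathbb{R}^n$.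
   Formalization: The formal theorem additionally assumes ιs ≥ 2, excluding only s = 1 with 1 < ι < 2, where the claim is false: for A = [1 1], s = 1, ι = 1.1, x = (1, −1) the coherence bound holds, but the inequalities would give 1 ≤ 0.318…. *)

(* Defs.v *)
From HB Require Import structures.
From mathcomp Require Import all_boot all_order all_algebra.
From mathcomp Require Import all_classical all_reals all_analysis.

Set Implicit Arguments.
Unset Strict Implicit.
Unset Printing Implicit Defensive.

Import Order.TTheory GRing.Theory Num.Theory.
Import numFieldNormedType.Exports.

Local Open Scope ring_scope.

Definition inner (R : realType) (m : nat) (u v : 'cV[R]_m) : R :=
  \sum_(k < m) u k 0 * v k 0.

Definition lqnorm (R : realType) (n : nat) (q : R) (x : 'cV[R]_n) : R :=
  (\sum_(i < n) `|x i 0| `^ q) `^ q^-1.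

(* [mx_norm] is the maximum of the absolute values of the entries. *)
Definition linfnorm (R : realType) (n : nat) (x : 'cV[R]_n) : R := mx_norm x.

Definition normalized_columns (R : realType) (m n : nat) (A : 'M[R]_(m, n)) :
    Prop :=
  forall i : 'I_n, lqnorm 2 (col i A) = 1.

(* The values are nonnegative, so the default value 0 of the maximum matters
   only when there is no pair i != j, i.e. n <= 1. *)
Definition coherence (R : realType) (m n : nat) (A : 'M[R]_(m, n)) : R :=
  \big[Num.max/0]_(p : 'I_n * 'I_n | p.1 != p.2)
    `|inner (col p.1 A) (col p.2 A)|.

(* [sort] is stable, so ties in absolute value are resolved in favour of the
   smaller index; the norms of x_max and x_rest do not depend on this choice. *)
Definition top_indices (R : realType) (n s : nat) (x : 'cV[R]_n) : seq 'I_n :=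
  take s (sort (fun i j => `|x j 0| <= `|x i 0|) (enum 'I_n)).

Definition x_max (R : realType) (n s : nat) (x : 'cV[R]_n) : 'cV[R]_n :=
  \col_i (if i \in top_indices s x then x i 0 else 0).

Definition x_rest (R : realType) (n s : nat) (x : 'cV[R]_n) : 'cV[R]_n :=
  x - x_max s x.

(* Both properties are meant for q >= 1. *)
Definition rnsp_l2 (R : realType) (m n : nat) (q : R) (s : nat)
    (A : 'M[R]_(m, n)) (rho tau : R) : Prop :=
  forall x : 'cV[R]_n,
    lqnorm q (x_max s x)
      <= rho * s%:R `^ (q^-1 - 1) * lqnorm 1 (x_rest s x)
         + tau * lqnorm 2 (A *m x).

Definition rnsp_dantzig (R : realType) (m n : nat) (q : R) (s : nat)
    (A : 'M[R]_(m, n)) (rho tau : R) : Prop :=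
  forall x : 'cV[R]_n,
    lqnorm q (x_max s x)
      <= rho * s%:R `^ (q^-1 - 1) * lqnorm 1 (x_rest s x)
         + tau * linfnorm (A^T *m (A *m x)).

(* Main.v *)
(* Write h = x_max(s), r = x - h, u = (iota s - 1) mu.  The Gram matrix A^T A
   is the identity up to off-diagonal entries of size at most mu, and h, r have
   disjoint supports, so
     <A x, A h> >= (1 - (s - 1) mu) |h|_2^2 - mu |h|_1 |r|_1
   with |h|_1 <= sqrt s |h|_2.  Bounding <A x, A h> above by |A x|_2 |A h|_2,
   respectively by |A^T A x|_oo |h|_1, and dividing by |h|_2 gives both
   properties with rho' = s mu / (1 - (s - 1) mu) in place of rho.  That
   rho' <= rho reduces to a quadratic in u whose discriminant is nonpositive
   exactly because iota s >= 2; no restricted isometry estimate is involved. *)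
Require Import Defs.
From HB Require Import structures.
From mathcomp Require Import all_boot all_order all_algebra.
From mathcomp Require Import all_classical all_reals all_analysis.
From mathcomp Require Import ring lra.

Set Implicit Arguments.
Unset Strict Implicit.
Unset Printing Implicit Defensive.

Import Order.TTheory GRing.Theory Num.Theory.
Import numFieldNormedType.Exports.

Local Open Scope ring_scope.

(** * Norm and inner product inequalities *)

Section Norms.
Variable R : realType.

Lemma lqnorm2E n (x : 'cV[R]_n) :
  lqnorm 2 x = Num.sqrt (\sum_(i < n) x i 0 ^+ 2).
Proof.
rewrite /lqnorm powR12_sqrt; last by apply: sumr_ge0 => i _; exact: powR_ge0.
congr Num.sqrt; apply: eq_bigr => i _.
by rewrite (powR_mulrn 2)// real_normK// num_real.
Qed.

Lemma lqnorm1E n (x : 'cV[R]_n) : lqnorm 1 x = \sum_(i < n) `|x i 0|.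
Proof.
rewrite /lqnorm invr1 powRr1; last by apply: sumr_ge0 => i _; exact: powR_ge0.
by apply: eq_bigr => i _; rewrite powRr1.
Qed.

Lemma lqnorm_ge0 n (q : R) (x : 'cV[R]_n) : 0 <= lqnorm q x.
Proof. exact: powR_ge0. Qed.

Lemma innerxx n (x : 'cV[R]_n) : inner x x = lqnorm 2 x ^+ 2.
Proof.
rewrite lqnorm2E sqr_sqrtr; last by apply: sumr_ge0 => i _; exact: sqr_ge0.
by apply: eq_bigr => i _; rewrite expr2.
Qed.

Lemma innerDl n (x y z : 'cV[R]_n) : inner (x + y) z = inner x z + inner y z.
Proof. by rewrite -big_split; apply: eq_bigr => i _; rewrite mxE mulrDl. Qed.

Lemma linfnorm_ge n (x : 'cV[R]_n) i : `|x i 0| <= linfnorm x.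
Proof.
rewrite /linfnorm mx_normrE.
exact: (le_bigmax _ (fun ij : 'I_n * 'I_1 => `|x ij.1 ij.2|) (i, 0)).
Qed.

Lemma linfnorm_ge0 n (x : 'cV[R]_n) : 0 <= linfnorm x.
Proof. by rewrite /linfnorm mx_normrE; exact: bigmax_ge_id. Qed.

(** Lagrange's identity: twice the gap between the sides is a double sum of squares. *)
Lemma sqr_sum_mul_le (I : finType) (a b : I -> R) :
  (\sum_i a i * b i) ^+ 2 <= (\sum_i a i ^+ 2) * (\sum_i b i ^+ 2).
Proof.
have : 0 <= \sum_i \sum_j (a i * b j - a j * b i) ^+ 2.
  by apply: sumr_ge0 => i _; apply: sumr_ge0 => j _; exact: sqr_ge0.
suff -> : \sum_i \sum_j (a i * b j - a j * b i) ^+ 2 =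
    2 * ((\sum_i a i ^+ 2) * (\sum_i b i ^+ 2) - (\sum_i a i * b i) ^+ 2).
  by rewrite pmulr_rge0// subr_ge0.
pose F i j := a i ^+ 2 * b j ^+ 2.
pose G i j := (a i * b i) * (a j * b j).
transitivity (\sum_i \sum_j (F i j + F j i - 2 * G i j)).
  by apply: eq_bigr => i _; apply: eq_bigr => j _; rewrite /F /G; ring.
under eq_bigr => i _ do rewrite sumrB big_split/=.
rewrite sumrB big_split/= [X in _ + X - _]exchange_big/=.
rewrite expr2 !big_distrlr/=.
have -> : \sum_i \sum_j 2 * G i j = 2 * \sum_i \sum_j G i j.
  by rewrite mulr_sumr; apply: eq_bigr => i _; rewrite mulr_sumr.
by rewrite /F /G; ring.
Qed.

Lemma inner_le n (x y : 'cV[R]_n) : inner x y <= lqnorm 2 x * lqnorm 2 y.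
Proof.
rewrite !lqnorm2E -sqrtrM; last by apply: sumr_ge0 => i _; exact: sqr_ge0.
by rewrite (le_trans (ler_norm _))// -sqrtr_sqr ler_sqrt// ?sqr_sum_mul_le//
  mulr_ge0// sumr_ge0// => i _; exact: sqr_ge0.
Qed.

Lemma inner_le_linf n (x y : 'cV[R]_n) : inner x y <= linfnorm x * lqnorm 1 y.
Proof.
rewrite lqnorm1E mulr_sumr; apply: ler_sum => i _.
by rewrite (le_trans (ler_norm _))// normrM ler_wpM2r// linfnorm_ge.
Qed.

(** Cauchy-Schwarz against the indicator of [S], which has at most [s] nonzero entries. *)
Lemma lqnorm1_sparse n s (S : seq 'I_n) (x : 'cV[R]_n) :
  (size S <= s)%N -> (forall i, i \notin S -> x i 0 = 0) ->
  lqnorm 1 x <= Num.sqrt s%:R * lqnorm 2 x.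
Proof.
move=> Ss x0; rewrite lqnorm1E lqnorm2E -sqrtrM//.
have sum0 : 0 <= \sum_(i < n) x i 0 ^+ 2.
  by apply: sumr_ge0 => i _; exact: sqr_ge0.
rewrite (le_trans (ler_norm _))// -sqrtr_sqr ler_sqrt ?mulr_ge0//.
have -> : \sum_(i < n) `|x i 0| = \sum_(i < n) (i \in S)%:R * `|x i 0|.
  apply: eq_bigr => i _; have [iS|iS] := boolP (i \in S); rewrite ?mul1r//.
  by rewrite x0// normr0 mulr0.
rewrite (le_trans (sqr_sum_mul_le _ _))//.
under [X in _ * X <= _]eq_bigr do rewrite real_normK ?num_real//.
rewrite ler_wpM2r//.
under eq_bigr do rewrite -natrX -mulnn mulnb andbb.
rewrite -natr_sum ler_nat (leq_trans _ Ss)// (leq_trans _ (card_size _))//.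
by rewrite -sum1_card [leqRHS]big_mkcond/=; apply: leq_sum => i _; case: ifP.
Qed.

End Norms.

(** * Gram matrix estimates from the coherence *)

Section Gram.
Variables (R : realType) (m n : nat) (A : 'M[R]_(m, n)).
Implicit Types x y h r : 'cV[R]_n.

Lemma coherence_ge0 : 0 <= coherence A.
Proof. exact: bigmax_ge_id. Qed.

Lemma inner_mulmx x y :
  inner (A *m x) (A *m y) =
  \sum_(i < n) \sum_(j < n) x i 0 * y j 0 * inner (col i A) (col j A).
Proof.
rewrite /inner; under eq_bigr do rewrite !mxE big_distrlr/=.
rewrite exchange_big; apply: eq_bigr => i _.
rewrite exchange_big; apply: eq_bigr => j _.
by rewrite mulr_sumr; apply: eq_bigr => k _; rewrite !mxE; ring.
Qed.

Lemma inner_mulmx_adj x y :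
  inner (A *m x) (A *m y) = inner (A^T *m (A *m x)) y.
Proof.
rewrite /inner; under eq_bigr do rewrite [(A *m y) _ _]mxE mulr_sumr.
rewrite exchange_big; apply: eq_bigr => j _.
rewrite [(A^T *m _) _ _]mxE mulr_suml; apply: eq_bigr => k _.
by rewrite !mxE; ring.
Qed.

Hypothesis hA : normalized_columns A.

(* The Gram matrix differs from the identity by a matrix with zero diagonal
   and off-diagonal entries bounded by the coherence. *)
Lemma inner_mulmx_dist x y :
  `|inner (A *m x) (A *m y) - inner x y| <=
  coherence A * (lqnorm 1 x * lqnorm 1 y - \sum_(i < n) `|x i 0 * y i 0|).
Proof.
(* Spreading single sums over the diagonal of a double sum allows a comparison entry by entry. *)
have diag (f : 'I_n -> R) :
    \sum_(i < n) f i = \sum_(i < n) \sum_(j < n) (i == j)%:R * f i.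
  apply: eq_bigr => i _; rewrite (bigD1 i)//= eqxx mul1r big1 ?addr0// => j.
  by rewrite eq_sym => /negPf ->; rewrite mul0r.
rewrite inner_mulmx [inner x y]/inner (diag (fun i => x i 0 * y i 0)).
rewrite (diag (fun i => `|x i 0 * y i 0|)) !lqnorm1E big_distrlr/=.
rewrite -!sumrB mulr_sumr (le_trans (ler_norm_sum _ _ _))// ler_sum// => i _.
rewrite -!sumrB mulr_sumr (le_trans (ler_norm_sum _ _ _))// ler_sum// => j _.
have [<-|ij] := eqVneq i j.
  by rewrite innerxx hA !mul1r expr1n mulr1 normrM !subrr normr0 mulr0.
rewrite !mul0r !subr0 !normrM mulrC ler_wpM2r ?mulr_ge0//.
exact: (le_bigmax_cond 0 (j := (i, j)) (P := fun p => p.1 != p.2)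
  (fun p => `|inner (col p.1 A) (col p.2 A)|) ij).
Qed.

(** The diagonal sum is |h|_2^2; removing it from |h|_1^2 <= s |h|_2^2 leaves the factor s - 1. *)
Lemma lqnorm_mulmx_dist s h : lqnorm 1 h <= Num.sqrt s%:R * lqnorm 2 h ->
  `|lqnorm 2 (A *m h) ^+ 2 - lqnorm 2 h ^+ 2| <=
  (s%:R - 1) * coherence A * lqnorm 2 h ^+ 2.
Proof.
move=> hs; rewrite -!innerxx (le_trans (inner_mulmx_dist _ _))//.
rewrite [_ * coherence A]mulrC -mulrA ler_wpM2l ?coherence_ge0//.
rewrite mulrBl mul1r lerB//; last first.
  by apply: ler_sum => i _; exact: ler_norm.
rewrite innerxx -expr2 -[s%:R]sqr_sqrtr// -exprMn.
by rewrite ler_sqr ?nnegrE ?mulr_ge0 ?lqnorm_ge0 ?sqrtr_ge0.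
Qed.

(** Disjoint supports make both [inner r h] and its diagonal sum vanish, so the cross term costs at
    most mu |r|_1 |h|_1. *)
Lemma inner_mulmx_lower s h r :
  lqnorm 1 h <= Num.sqrt s%:R * lqnorm 2 h ->
  (forall i, r i 0 * h i 0 = 0) ->
  (1 - (s%:R - 1) * coherence A) * lqnorm 2 h ^+ 2
    - coherence A * (lqnorm 1 r * (Num.sqrt s%:R * lqnorm 2 h))
  <= inner (A *m (h + r)) (A *m h).
Proof.
move=> hs rh; rewrite mulmxDr innerDl innerxx lerD//.
  rewrite mulrBl mul1r -lerBrDl.
  by have := lqnorm_mulmx_dist hs; rewrite ler_norml => /andP[].
have := inner_mulmx_dist r h.
rewrite {2}/inner !big1 => [|i _|i _]; last 2 first.
- by rewrite rh normr0.
- by rewrite rh.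
rewrite !subr0 ler_norml => /andP[+ _]; apply: le_trans.
rewrite lerN2; apply: ler_wpM2l; first exact: coherence_ge0.
exact: (ler_wpM2l (lqnorm_ge0 1 r) hs).
Qed.

End Gram.

(** * Scalar inequalities between the constants *)

Section Constants.
Variable R : realType.

(* Writing b = s - 1, d = a - b, the difference of both sides is
   C0 - 2 a b u + C2 u^2 with C0 = d^2 - d + a b and C2 = a b + d, and
   C0 C2 - (a b)^2 = d^2 (a - 1) (b + 1) is nonnegative. *)
Lemma discriminant_le (a s u : R) : 1 <= a -> 1 <= s -> s < a + 1 ->
  s * (a + 1 - s) * (1 - u ^+ 2) <= (a - (s - 1) * u) ^+ 2.
Proof.
move=> a1 s1 sa; rewrite -subr_ge0.
have ab0 : 0 <= a * (s - 1) by rewrite mulr_ge0//; lra.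
have C2 : 0 < a * (s - 1) + (a + 1 - s) by lra.
(* Multiplying by the leading coefficient C2 completes the square in [u]. *)
rewrite -(pmulr_rge0 _ C2).
suff -> : (a * (s - 1) + (a + 1 - s)) *
    ((a - (s - 1) * u) ^+ 2 - s * (a + 1 - s) * (1 - u ^+ 2)) =
    ((a * (s - 1) + (a + 1 - s)) * u - a * (s - 1)) ^+ 2
    + (a + 1 - s) ^+ 2 * ((a - 1) * s).
  by rewrite addr_ge0 ?sqr_ge0// mulr_ge0 ?sqr_ge0// mulr_ge0//; lra.
by ring.
Qed.

Lemma rho_ge (iota s mu : R) : 1 < iota -> 1 <= s -> 2 <= iota * s ->
  0 <= mu -> (iota * s - 1) * mu < 1 ->
  s * mu / (1 - (s - 1) * mu) <=
  (iota * s - 1) * mu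
    / Num.sqrt ((iota - 1) * (1 - ((iota * s - 1) * mu) ^+ 2)).
Proof.
move=> i1 s1 is2 mu0; set a := iota * s - 1; set u := a * mu => u1.
have a1 : 1 <= a by rewrite /a; lra.
have sa : s < a + 1 by rewrite /a subrK ltr_pMl//; lra.
have u0 : 0 <= u by rewrite mulr_ge0//; lra.
have bmu : (s - 1) * mu <= u by rewrite /u ler_wpM2r//; lra.
have den : 0 < (iota - 1) * (1 - u ^+ 2).
  by rewrite mulr_gt0 ?subr_gt0// expr_lt1.
(* This is the claim cross-multiplied and divided by [mu]. Since a + 1 - s = s (iota - 1), its
   square is [discriminant_le]. *)
have key : s * Num.sqrt ((iota - 1) * (1 - u ^+ 2)) <= a - (s - 1) * u.
  rewrite -ler_sqr ?nnegrE ?mulr_ge0 ?sqrtr_ge0//; last 2 first.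
  - lra.
  - have : (s - 1) * u <= a * 1 by rewrite ler_pM//; lra.
    lra.
  rewrite exprMn sqr_sqrtr; last exact: ltW.
  suff <- : s * (a + 1 - s) * (1 - u ^+ 2) =
      s ^+ 2 * ((iota - 1) * (1 - u ^+ 2)).
    exact: discriminant_le.
  by rewrite /a; ring.
rewrite ler_pdivrMr; last lra.
rewrite mulrAC ler_pdivlMr ?sqrtr_gt0//.
have := ler_wpM2r mu0 key; rewrite /u; lra.
Qed.

(** The factor 2 absorbs 1 + u: 1 - u^2 = (1 - u)(1 + u) <= 2 (1 - u) <= 2 (1 - b). *)
Lemma tau_ge (c c' b u : R) : 0 <= c' -> c <= c' -> b <= u -> 0 <= u < 1 ->
  c / (1 - b) <= 2 * c' / (1 - u ^+ 2).
Proof.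
move=> c0 cc' bu /andP[u0 u1].
have u2 : 0 < 1 - u ^+ 2 by rewrite subr_gt0 expr_lt1.
rewrite ler_pdivrMr ?subr_gt0; last lra.
rewrite mulrAC ler_pdivlMr//.
apply: (@le_trans _ _ (c' * (1 - u ^+ 2))); first by rewrite ler_wpM2r// ltW.
have : 0 <= c' * (1 - b - (1 - u)) by rewrite mulr_ge0//; lra.
have : 0 <= c' * (1 - u) ^+ 2 by rewrite mulr_ge0 ?sqr_ge0.
lra.
Qed.

Lemma mu_lt1 (iota a mu : R) : 1 < iota -> 0 < a ->
  mu < Num.sqrt (iota - 1) / (Num.sqrt iota * a) -> a * mu < 1.
Proof.
move=> i1 a0; have i0 : 0 < iota by lra.
rewrite ltr_pdivlMr ?mulr_gt0 ?sqrtr_gt0// => H.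
have : Num.sqrt (iota - 1) < Num.sqrt iota by rewrite ltr_sqrt//; lra.
move=> /(lt_trans H); rewrite mulrCA -[ltRHS]mulr1 ltr_pM2l ?sqrtr_gt0//.
by rewrite mulrC.
Qed.

(** Here [h] and [r] stand for |x_max|_2 and |x_rest|_1, and [E] for the measurement term; the
    quadratic bound is divided by [h]. *)
Lemma robust_of_quadratic (s mu h r c E : R) : 0 < s -> 0 <= h -> 0 <= mu ->
  0 <= r -> 0 <= c * E -> 0 < 1 - (s - 1) * mu ->
  (1 - (s - 1) * mu) * h ^+ 2 - mu * (r * (Num.sqrt s * h)) <= c * E * h ->
  h <= s * mu / (1 - (s - 1) * mu) * (r / Num.sqrt s)
       + c / (1 - (s - 1) * mu) * E.
Proof.
set d := 1 - _ => s0 h0 mu0 r0 cE0 d0 H.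
have ss0 : 0 < Num.sqrt s by rewrite sqrtr_gt0.
have -> : s * mu / d * (r / Num.sqrt s) + c / d * E =
    (mu * Num.sqrt s * r + c * E) / d.
  rewrite -{1}(sqr_sqrtr (ltW s0)); field.
  by rewrite !gt_eqF.
rewrite ler_pdivlMr//.
(* For h = 0 no division is possible, but the right-hand side is nonnegative. *)
move: h0; rewrite le_eqVlt => /predU1P[<-|h0].
  by rewrite mul0r addr_ge0// !mulr_ge0// ltW.
rewrite -(ler_pM2r h0); lra.
Qed.

End Constants.

Lemma size_top_indices (R : realType) (n s : nat) (x : 'cV[R]_n) :
  (size (top_indices s x) <= s)%N.
Proof. by rewrite size_take; case: ltnP. Qed.

(* [iota * s] is a sparsity level (the order of a restricted isometry constant
   estimated through the coherence of pairs of columns); [hs2] makes explicit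
   that it is at least 2.  It is automatic when [2 <= s], when [2 <= iota], or
   when [iota * s] is an integer.  It cannot be dropped: for s = 1,
   iota = 11/10, A = [1 1] and x = (1, -1) both inequalities fail. *)
Theorem theorem4p3 (R : realType) (iota : R) (m n s : nat) (A : 'M[R]_(m, n))
    (hiota : 1 < iota) (hmn : (m < n)%N) (hs : (1 <= s <= n)%N)
    (hs2 : 2 <= iota * s%:R)
    (hA : normalized_columns A)
    (hmu : coherence A
             < Num.sqrt (iota - 1) / (Num.sqrt iota * (iota * s%:R - 1))) :
  let mu := coherence A in
  let rho := (iota * s%:R - 1) * mu
               / Num.sqrt ((iota - 1) * (1 - ((iota * s%:R - 1) * mu) ^+ 2)) in
  let tau1 := 2 * Num.sqrt (1 + (iota * s%:R - 1) * mu)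
                / (1 - ((iota * s%:R - 1) * mu) ^+ 2) in
  let tau2 := 2 * Num.sqrt (iota * s%:R)
                / (1 - ((iota * s%:R - 1) * mu) ^+ 2) in
  [/\ forall x : 'cV[R]_n,
        lqnorm 2 (x_max s x)
          <= rho * (lqnorm 1 (x_rest s x) / Num.sqrt s%:R)
             + tau1 * lqnorm 2 (A *m x),
      forall x : 'cV[R]_n,
        lqnorm 2 (x_max s x)
          <= rho * (lqnorm 1 (x_rest s x) / Num.sqrt s%:R)
             + tau2 * linfnorm (A^T *m (A *m x)),
      rnsp_l2 2 s A rho tau1
    & rnsp_dantzig 2 s A rho tau2].
Proof.
have s1 : 1 <= s%:R :> R by rewrite ler1n; case/andP: hs.
have s0 : 0 < s%:R :> R := lt_le_trans ltr01 s1.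
have mu0 := coherence_ge0 A.
have u1 : (iota * s%:R - 1) * coherence A < 1.
  by apply: mu_lt1 hmu => //; lra.
have u0 : 0 <= (iota * s%:R - 1) * coherence A by rewrite mulr_ge0//; lra.
have bu : (s%:R - 1) * coherence A <= (iota * s%:R - 1) * coherence A.
  by rewrite ler_wpM2r// lerB// ler_peMl// ltW.
have d0 : 0 < 1 - (s%:R - 1) * coherence A by lra.
move=> mu rho tau1 tau2.
have sparse (x : 'cV[R]_n) :
    lqnorm 1 (x_max s x) <= Num.sqrt s%:R * lqnorm 2 (x_max s x).
  apply: (lqnorm1_sparse (size_top_indices s x)) => i iS.
  by rewrite mxE (negPf iS).
have lower (x : 'cV[R]_n) := inner_mulmx_lower hA (r := x_rest s x) (sparse x).
have disj (x : 'cV[R]_n) i : x_rest s x i 0 * x_max s x i 0 = 0.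
  by rewrite !mxE; case: ifP => _; rewrite ?subrr ?mul0r ?mulr0.
have xE (x : 'cV[R]_n) : x_max s x + x_rest s x = x by rewrite addrC subrK.
(* Common end of both bounds: [c] is the constant the argument yields, [c'] the larger one appearing
   in [tau1] or [tau2]. *)
have combine (x : 'cV[R]_n) c c' E : 0 <= c -> c <= c' -> 0 <= E ->
    inner (A *m x) (A *m x_max s x) <= c * E * lqnorm 2 (x_max s x) ->
    lqnorm 2 (x_max s x) <= rho * (lqnorm 1 (x_rest s x) / Num.sqrt s%:R)
      + 2 * c' / (1 - ((iota * s%:R - 1) * mu) ^+ 2) * E.
  move=> c0 cc' E0 H.
  have := lower x (disj x); rewrite xE => /le_trans/(_ H) quad.
  have := robust_of_quadratic s0 (lqnorm_ge0 _ _) mu0 (lqnorm_ge0 _ _)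
    (mulr_ge0 c0 E0) d0 quad.
  move=> /le_trans; apply.
  apply: lerD; apply: ler_wpM2r => //.
  - exact: divr_ge0 (lqnorm_ge0 _ _) (sqrtr_ge0 _).
  - exact: rho_ge.
  - by apply: tau_ge => //; rewrite ?u0// (le_trans c0).
have l2 (x : 'cV[R]_n) : lqnorm 2 (x_max s x) <=
    rho * (lqnorm 1 (x_rest s x) / Num.sqrt s%:R) + tau1 * lqnorm 2 (A *m x).
  (* This constant bounds |A h|_2 / |h|_2 for h = [x_max s x]. *)
  apply: (combine x (Num.sqrt (1 + (s%:R - 1) * mu))).
  - exact: sqrtr_ge0.
  - by rewrite ler_wsqrtr// lerD2l.
  - exact: lqnorm_ge0.
  rewrite (le_trans (inner_le _ _))// mulrAC mulrC ler_wpM2r ?lqnorm_ge0//.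
  have b0 : 0 <= (s%:R - 1) * mu by rewrite mulr_ge0//; lra.
  rewrite -ler_sqr ?nnegrE ?mulr_ge0 ?lqnorm_ge0 ?sqrtr_ge0//.
  rewrite exprMn sqr_sqrtr ?addr_ge0//.
  rewrite mulrDl mul1r -lerBlDl.
  by have := lqnorm_mulmx_dist hA (sparse x); rewrite ler_norml => /andP[].
have dantzig (x : 'cV[R]_n) : lqnorm 2 (x_max s x) <=
    rho * (lqnorm 1 (x_rest s x) / Num.sqrt s%:R)
    + tau2 * linfnorm (A^T *m (A *m x)).
  (* Here the constant comes from |h|_1 <= sqrt s |h|_2. *)
  apply: (combine x (Num.sqrt s%:R)).
  - exact: sqrtr_ge0.
  - by rewrite ler_wsqrtr// ler_peMl// ltW.
  - exact: linfnorm_ge0.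
  rewrite inner_mulmx_adj; apply: le_trans (inner_le_linf _ _) _.
  by rewrite [Num.sqrt _ * _]mulrC -mulrA ler_wpM2l ?linfnorm_ge0.
have powE : s%:R `^ (2^-1 - 1) = (Num.sqrt s%:R)^-1 :> R.
  by rewrite (_ : 2^-1 - 1 = - 2^-1 :> R) ?powRN ?powR12_sqrt//; lra.
split=> // x; rewrite powE -mulrA [_^-1 * _]mulrC.
  exact: l2.
exact: dantzig.
Qed.
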